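(* Consider the problem $\min_{x\in\mathbb{R}^d}F(x)$ with $F(x)=f(x)+\Psi(x)=\frac1n\sum_{i=1}^n f_i(x)+\Psi(x)$, and let $x^*$ be a minimizer of $F$. If each $f_i$ (not necessarily convex) is $L$-upper smooth and $l$-lower smooth for $0\le l\le L$, $f$ is $\sigma$-strongly convex, $\eta=\min\{\frac1{21L},\frac{\sigma}{63Ll}\}$ (the second term read as $+\infty$ if $l=0$), and $m\ge\frac{10}{\sigma\eta}=\Omega\big(\max\{\frac L\sigma,\frac{Ll}{\sigma^2}\}\big)$, then $\mathtt{SVRG}(x^\phi,m,S,\eta)$ satisfies, for each epoch $s$, $$\mathbb{E}\big[F(\widetilde{x}^s)-F(x^* )\big]\le\frac34\big(F(\widetilde{x}^{s-1})-F(x^* )\big),$$ where the first $s-1$ epochs are assumed fixed and the only randomness comes from epoch $s$. Therefore, by setting $S=\log_{4/3}\big(\frac{F(x^\phi)-F(x^* )}{\varepsilon}\big)$, in a total gradient complexity of $$O\Big(\Big(n+\frac L\sigma\max\Big\{1,\frac l\sigma\Big\}\Big)\log\frac{F(x^\phi)-F(x^* )}{\varepsilon}\Big),$$ we obtain an output $\widetilde{x}^S$ satisfying $\mathbb{E}[F(\widetilde{x}^S)-F(x^* )]\le\varepsilon$.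
   Context: Setting: each $f_i:\mathbb{R}^d\to\mathbb{R}$ is differentiable; $\Psi$ is convex and lower semicontinuous (possibly non-differentiable). $\|\cdot\|$ is the Euclidean norm. A differentiable function $g$ is: $L$-upper smooth if $g(y)-g(x)-\langle\nabla g(x),y-x\rangle\le\frac L2\|y-x\|^2$ for all $x,y\in\mathbb{R}^d$; $l$-lower smooth if $g(y)-g(x)-\langle\nabla g(x),y-x\rangle\ge-\frac l2\|y-x\|^2$ for all $x,y$; $\sigma$-strongly convex if $g(y)-g(x)-\langle\nabla g(x),y-x\rangle\ge\frac\sigma2\|y-x\|^2$ for all $x,y$. The target accuracy is $\varepsilon$. Algorithm $\mathtt{SVRG}(x^\phi,m,S,\eta)$, with starting vector $x^\phi$, epoch length $m$, number of epochs $S$ and step length $\eta$: Set $\widetilde{x}^0=x^\phi$ and $x_0^1=x^\phi$. For epochs $s=1,\dots,S$: compute $\widetilde\mu_{s-1}=\nabla f(\widetilde{x}^{s-1})$; for $t=0,\dots,m-1$ pick $i$ uniformly at random in $\{1,\dots,n\}$, set $\xi=\nabla f_i(x_t^s)-\nabla f_i(\widetilde{x}^{s-1})+\widetilde\mu_{s-1}$ and $x_{t+1}^s=\arg\min_{y\in\mathbb{R}^d}\{\frac1{2\eta}\|x_t^s-y\|^2+\Psi(y)+\langle\xi,y\rangle\}$; after the inner loop set $\widetilde{x}^s=\frac1m\sum_{t=1}^m x_t^s$ and $x_0^{s+1}=\widetilde{x}^s$. Return $\widetilde{x}^S$. The gradient complexity is the total number of evaluations of component gradients $\nabla f_i(\cdot)$;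 a full gradient $\nabla f$ counts as $n$ evaluations. *)

(* Defs.v *)
From HB Require Import structures.
From mathcomp Require Import all_boot all_order all_algebra.
From mathcomp Require Import all_classical all_reals all_analysis.
Import Order.TTheory GRing.Theory Num.Theory.
Import numFieldNormedType.Exports.

Set Implicit Arguments.
Unset Strict Implicit.
Unset Printing Implicit Defensive.

Local Open Scope classical_set_scope.
Local Open Scope ring_scope.

Section Geometry.
Context {R : realType} {d : nat}.
Implicit Types (g : 'rV[R]_d -> R) (x y : 'rV[R]_d) (L l sigma : R).

Definition dotp x y : R := \sum_(j < d) x 0 j * y 0 j.

(* The norm that the library puts on 'rV[R]_d is the sup norm, so the
   Euclidean norm is defined separately; the topology, and hence
   differentiability and lower semicontinuity, is the same for both. *)
Definition enorm x : R := Num.sqrt (dotp x x).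

Definition grad g x : 'rV[R]_d := \row_(j < d) 'D_(delta_mx 0 j) g x.

Definition upper_smooth L g :=
  forall x y, g y - g x - dotp (grad g x) (y - x) <= L / 2 * enorm (y - x) ^+ 2.

Definition lower_smooth l g :=
  forall x y,
    - (l / 2 * enorm (y - x) ^+ 2) <= g y - g x - dotp (grad g x) (y - x).

Definition strongly_convex sigma g :=
  forall x y,
    sigma / 2 * enorm (y - x) ^+ 2 <= g y - g x - dotp (grad g x) (y - x).

Definition proper_fun (Psi : 'rV[R]_d -> \bar R) :=
  (forall x, Psi x != -oo%E) /\ (exists x, Psi x != +oo%E).

Definition convex_ereal (Psi : 'rV[R]_d -> \bar R) :=
  forall x y (t : R), 0 <= t <= 1 ->
    (Psi (t *: x + (1 - t) *: y)%R <= t%:E * Psi x + (1 - t)%:E * Psi y)%E.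

(* A chosen minimizer (0 if there is none). *)
Definition argmin (h : 'rV[R]_d -> \bar R) : 'rV[R]_d :=
  xget 0 [set y | forall z, (h y <= h z)%E].

End Geometry.

(* Expectation under the uniform distribution on a finite type.  On
   m.-tuple 'I_n it is the expectation over m independent uniform picks. *)
Definition expect {R : realType} {T : finType} (X : T -> \bar R) : \bar R :=
  ((#|T|%:R^-1)%:E * \sum_(w : T) X w)%E.

Section Algorithm.
Context {R : realType} {d n : nat}.
Variables (f : 'I_n -> 'rV[R]_d -> R) (Psi : 'rV[R]_d -> \bar R).

Definition favg (x : 'rV[R]_d) : R := n%:R^-1 * \sum_(i < n) f i x.

Definition objective (x : 'rV[R]_d) : \bar R := ((favg x)%:E + Psi x)%E.

Variables (m : nat) (eta : R).

Definition prox_step (xi x : 'rV[R]_d) : 'rV[R]_d :=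
  argmin (fun y =>
    ((1 / (2 * eta) * enorm (x - y) ^+ 2)%:E + Psi y + (dotp xi y)%:E)%E).

(* The state of the algorithm is the current vector together with the number
   of component gradients evaluated so far. *)
Definition inner_step (xt mu : 'rV[R]_d) (st : 'rV[R]_d * nat) (i : 'I_n) :=
  let xi := grad (f i) st.1 - grad (f i) xt + mu in
  (prox_step xi st.1, (st.2 + 2)%N).

(* scanl lists the states of the inner loop for t = 1, ..., m. *)
Definition epoch (st : 'rV[R]_d * nat) (w : m.-tuple 'I_n) : 'rV[R]_d * nat :=
  let xt := st.1 in
  let mu := grad favg xt in
  let st0 := (xt, (st.2 + n)%N) in
  let iterates := scanl (inner_step xt mu) st0 w in
  (m%:R^-1 *: \sum_(p <- iterates) p.1, (last st0 iterates).2).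

(* The entry s of ws lists the m indices picked in the epoch s + 1, and the
   number of epochs is the length of ws. *)
Definition svrg_run (x0 : 'rV[R]_d) (ws : seq (m.-tuple 'I_n)) :=
  foldl epoch (x0, 0%N) ws.

Definition svrg x0 ws : 'rV[R]_d := (svrg_run x0 ws).1.

Definition gradient_complexity x0 ws : nat := (svrg_run x0 ws).2.

End Algorithm.

Section Choices.
Context {R : realType}.
Implicit Types L l sigma x : R.

(* The case l = 0 is separate because sigma / 0 is 0 here and not +oo. *)
Definition step_length L l sigma : R :=
  if l == 0 then 1 / (21 * L)
  else Num.min (1 / (21 * L)) (sigma / (63 * L * l)).

(* The least natural number that is at least x. *)
Definition ceiln x : nat := `|(Num.ceil (Num.max 0 x))%R|%N.

Definition log43 x : R := ln x / ln (4 / 3).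

End Choices.

(* Main.v *)
(** Let xs be the minimizer and D(x) = F(x) - F(xs).  Adding l/2 |.|^2 to each f_i gives
    convex smooth functions, so a gradient step on them bounds the mean of
    |grad f_i x - grad f_i xs|^2 by 2 (L + l) (D(x) + l/2 |x - xs|^2); strong
    convexity turns this into 4 L (1 + l/sigma) D(x), which is where the step
    length min {1/(21 L), sigma/(63 L l)} comes from.  Hence the SVRG estimator
    has variance of order L (1 + l/sigma) (D(x) + D(x~)), and the proximal
    descent inequality yields
      E [D(x+) + |x+ - xs|^2 / (2 eta)]
        <= |x - xs|^2 / (2 eta) + 4/15 (D(x) + D(x~)).
    Telescoping over an epoch of length m >= 10/(sigma eta), with
    |x~ - xs|^2 <= (2/sigma) D(x~) and Jensen's inequality for the average,
    gives the factor 3/4. *)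
Require Import Defs.
From HB Require Import structures.
From mathcomp Require Import all_boot all_order all_algebra.
From mathcomp Require Import all_classical all_reals all_analysis.
From mathcomp Require Import ring lra.
Import Order.TTheory GRing.Theory Num.Theory.
Import numFieldNormedType.Exports.

Set Implicit Arguments.
Unset Strict Implicit.
Unset Printing Implicit Defensive.

Local Open Scope classical_set_scope.
Local Open Scope ring_scope.

(** * Euclidean inner product in coordinates *)

Section InnerProduct.
Context {R : realType} {d : nat}.
Implicit Types (x y z : 'rV[R]_d) (a : R).

Lemma dotpC x y : dotp x y = dotp y x.
Proof. by apply: eq_bigr => j _; rewrite mulrC. Qed.

Lemma dotpDl x y z : dotp (x + y) z = dotp x z + dotp y z.
Proof. by rewrite -big_split; apply: eq_bigr => j _; rewrite mxE mulrDl. Qed.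

Lemma dotpZl a x y : dotp (a *: x) y = a * dotp x y.
Proof. by rewrite mulr_sumr; apply: eq_bigr => j _; rewrite mxE mulrA. Qed.

Lemma dotpNl x y : dotp (- x) y = - dotp x y.
Proof. by rewrite -scaleN1r dotpZl mulN1r. Qed.

Lemma dotpBl x y z : dotp (x - y) z = dotp x z - dotp y z.
Proof. by rewrite dotpDl dotpNl. Qed.

Lemma dotpDr x y z : dotp x (y + z) = dotp x y + dotp x z.
Proof. by rewrite dotpC dotpDl !(dotpC x). Qed.

Lemma dotpZr a x y : dotp x (a *: y) = a * dotp x y.
Proof. by rewrite dotpC dotpZl dotpC. Qed.

Lemma dotpNr x y : dotp x (- y) = - dotp x y.
Proof. by rewrite dotpC dotpNl dotpC. Qed.

Lemma dotpBr x y z : dotp x (y - z) = dotp x y - dotp x z.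
Proof. by rewrite dotpDr dotpNr. Qed.

Definition dotpE := (dotpBl, dotpBr, dotpDl, dotpDr, dotpNl, dotpNr, dotpZl, dotpZr).

Lemma dotp0l y : dotp 0 y = 0.
Proof. by rewrite -(scale0r y) dotpZl mul0r. Qed.

Lemma dotp_suml (I : Type) (s : seq I) (F : I -> 'rV[R]_d) y :
  dotp (\sum_(i <- s) F i) y = \sum_(i <- s) dotp (F i) y.
Proof.
elim: s => [|i s IH]; first by rewrite !big_nil dotp0l.
by rewrite !big_cons dotpDl IH.
Qed.

Lemma dotp_ge0 x : 0 <= dotp x x.
Proof. by apply: sumr_ge0 => j _; rewrite -expr2 sqr_ge0. Qed.

Lemma coord_sqr_le x j : x 0 j ^+ 2 <= dotp x x.
Proof.
rewrite /dotp (bigD1 j) //= -expr2 lerDl.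
by apply: sumr_ge0 => k _; rewrite -expr2 sqr_ge0.
Qed.

Lemma enorm_sqr x : enorm x ^+ 2 = dotp x x.
Proof. by rewrite sqr_sqrtr // dotp_ge0. Qed.

End InnerProduct.

(** * Uniform means over finite types *)

Section Mean.
Context {R : realType}.

Definition mean {T : finType} (X : T -> R) : R := #|T|%:R^-1 * \sum_w X w.

Lemma expect_EFin (T : finType) (X : T -> R) :
  expect (fun w => (X w)%:E) = (mean X)%:E.
Proof. by rewrite /expect sumEFin. Qed.

Section Finite.
Context {T : finType}.
Implicit Types X Y : T -> R.

Lemma eq_mean X Y : X =1 Y -> mean X = mean Y.
Proof. by move=> XY; congr (_ * _); apply: eq_bigr. Qed.

Lemma le_mean X Y : (forall w, X w <= Y w) -> mean X <= mean Y.
Proof. by move=> XY; rewrite ler_wpM2l ?invr_ge0 // ler_sum. Qed.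

Lemma meanD X Y : mean (fun w => X w + Y w) = mean X + mean Y.
Proof. by rewrite /mean big_split mulrDr. Qed.

Lemma meanZ (a : R) X : mean (fun w => a * X w) = a * mean X.
Proof. by rewrite /mean -mulr_sumr mulrCA. Qed.

Lemma meanN X : mean (fun w => - X w) = - mean X.
Proof. by rewrite -mulN1r -meanZ; apply: eq_mean => w; rewrite mulN1r. Qed.

Lemma mean_const (a : R) : (0 < #|T|)%N -> mean (fun _ : T => a) = a.
Proof.
move=> T0; rewrite /mean sumr_const -[a *+ _]mulr_natl mulrA mulVf ?mul1r //.
by rewrite pnatr_eq0 -lt0n.
Qed.

End Finite.

Lemma mean_ord (n : nat) (X : 'I_n -> R) : mean X = n%:R^-1 * \sum_i X i.
Proof. by rewrite /mean card_ord. Qed.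

Lemma mean_tuple0 (T : finType) (X : 0.-tuple T -> R) : mean X = X [tuple].
Proof.
rewrite (@eq_mean _ X (fun _ => X [tuple])); last first.
  by move=> w; rewrite tuple0.
by rewrite mean_const // card_tuple.
Qed.

(** Conditioning on the first pick: a tuple of length [k.+1] is the same as its head and its tail.
    The inductions over picks and over epochs both rest on this. *)
Lemma mean_tuple_cons (T : finType) (k : nat) (X : k.+1.-tuple T -> R) :
  mean X = mean (fun i => mean (fun w : k.-tuple T => X [tuple of i :: w])).
Proof.
rewrite /mean !card_tuple -mulr_sumr pair_big mulrA.
congr (_ * _); first by rewrite expnS natrM invfM.
rewrite (reindex (fun p : T * k.-tuple T => [tuple of p.1 :: p.2])) //=.
exists (fun w => (thead w, [tuple of behead w])) => [[i w] _|w _] /=.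
  by congr (_, _); apply: val_inj.
by rewrite -tuple_eta.
Qed.

End Mean.

(** * Second moments of random vectors *)

Section MeanSquare.
Context {R : realType} {d : nat} {T : finType}.
Implicit Types (a b g : T -> 'rV[R]_d) (h : 'rV[R]_d).

(** The difference of the two sides is [dotp h h]. That [h] is the mean of [g] is expressed by
    testing against every vector [v]. *)
Lemma mean_sq_center g h : (0 < #|T|)%N ->
  (forall v, mean (fun i => dotp (g i) v) = dotp h v) ->
  mean (fun i => dotp (g i - h) (g i - h)) <= mean (fun i => dotp (g i) (g i)).
Proof.
move=> T0 gh.
have -> : mean (fun i => dotp (g i - h) (g i - h)) =
    mean (fun i => dotp (g i) (g i) + (- 2 * dotp (g i) h + dotp h h)).
  by apply: eq_mean => i; rewrite dotpBl !dotpBr (dotpC h (g i)); ring.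
rewrite meanD meanD (meanZ (- 2)) gh (mean_const _ T0).
by have := dotp_ge0 h; lra.
Qed.

Lemma mean_sqB a b : mean (fun i => dotp (a i - b i) (a i - b i)) <=
  2 * mean (fun i => dotp (a i) (a i)) + 2 * mean (fun i => dotp (b i) (b i)).
Proof.
rewrite -!meanZ -meanD; apply: le_mean => i; move: (a i) (b i) => x y.
by have := dotp_ge0 (x + y); rewrite !dotpE (dotpC y x); lra.
Qed.

End MeanSquare.

(** * Smoothness and strong convexity of a single function *)

Section Smoothness.
Context {R : realType} {d : nat}.
Implicit Types (g : 'rV[R]_d -> R) (x y : 'rV[R]_d) (L l sigma : R).

(* [g + l / 2 * |.|^2] is convex and (L + l)-upper smooth; the bound follows
   from evaluating its Bregman gap after one gradient step of length
   1 / (L + l). *)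
Lemma grad_gap g L l x y : 0 < L + l -> upper_smooth L g -> lower_smooth l g ->
  dotp (grad g x - grad g y + l *: (x - y)) (grad g x - grad g y + l *: (x - y))
  <= 2 * (L + l) *
    (g x - g y - dotp (grad g y) (x - y) + l / 2 * dotp (x - y) (x - y)).
Proof.
move=> M0 up lo; set v := x - y; set G := grad g x - grad g y + _.
set s := (L + l)^-1 *: G.
(* The value [g (x - s)] is squeezed between its lower expansion at [y] and its upper expansion at
   [x]. *)
have := up x (x - s); have := lo y (x - s).
have -> : x - s - x = - s by rewrite addrAC subrr add0r.
have -> : x - s - y = v - s by rewrite addrAC.
rewrite !enorm_sqr.
have Gs : dotp (grad g x) s - dotp (grad g y) s + l * dotp v s = (L + l)^-1 * dotp G G.
  by rewrite -dotpBl -dotpZl -dotpDl dotpZr.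
have ss : dotp s s = (L + l)^-1 * ((L + l)^-1 * dotp G G).
  by rewrite dotpZl dotpZr.
clearbody s; clearbody G; clearbody v.
rewrite !dotpE (dotpC s v) => lo' up'.
have : 0 <= g x - g y - dotp (grad g y) v + l / 2 * dotp v v
    - (dotp (grad g x) s - dotp (grad g y) s + l * dotp v s)
    + (L + l) / 2 * dotp s s by lra.
rewrite Gs ss; set q := dotp G G; set gap := g x - g y - _ + _ => h.
(* With M = L + l, [h] says that [gap] is at least q/M - q/(2M) = q/(2M); the identity rewrites [q]
   as 2M times this quantity. *)
have -> : q = 2 * (L + l) * ((L + l)^-1 * q - (L + l) / 2 * ((L + l)^-1 * ((L + l)^-1 * q))).
  by field; rewrite gt_eqF.
by rewrite ler_pM2l ?mulr_gt0 //; lra.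
Qed.

Lemma strongly_convex_monotone sigma g x y : strongly_convex sigma g ->
  sigma * dotp (x - y) (x - y) <= dotp (grad g x - grad g y) (x - y).
Proof.
move=> cvx; have := cvx x y; have := cvx y x; rewrite !enorm_sqr.
by rewrite -[y - x]opprB dotpNl !dotpNr opprK !dotpBl; lra.
Qed.

End Smoothness.

(** * The average of the components *)

Section FiniteSum.
Context {R : realType} {d n : nat}.
Variable f : 'I_n -> 'rV[R]_d -> R.
Hypothesis n0 : (0 < n)%N.
Hypothesis df : forall i x, differentiable (f i) x.

Lemma grad_favg x : grad (favg f) x = n%:R^-1 *: \sum_i grad (f i) x.
Proof.
apply/rowP => j; rewrite !mxE summxE.
have dfj i : derivable (f i) x (delta_mx 0 j) by exact: diff_derivable.
have -> : favg f = n%:R^-1 \*: (\sum_i f i).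
  by apply/funext => z; rewrite /favg /GRing.scale_fun /= fct_sumE.
rewrite deriveZ; last exact: derivable_sum.
by rewrite derive_sum //; congr (_ * _); apply: eq_bigr => i _; rewrite mxE.
Qed.

Lemma dotp_grad_favg x y :
  dotp (grad (favg f) x) y = mean (fun i => dotp (grad (f i) x) y).
Proof. by rewrite grad_favg dotpZl dotp_suml mean_ord. Qed.

Lemma favg_mean x : favg f x = mean (fun i => f i x).
Proof. by rewrite mean_ord. Qed.

Lemma favg_upper_smooth (L : R) :
  (forall i, upper_smooth L (f i)) -> upper_smooth L (favg f).
Proof.
move=> up x y; rewrite dotp_grad_favg !favg_mean -!meanN -!meanD.
rewrite -[leRHS](@mean_const _ 'I_n) ?card_ord //.
by apply: le_mean => i; exact: up.
Qed.

Lemma grad_variance (L l sigma : R) x y : 0 <= l -> 0 < L + l -> 0 <= sigma ->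
  (forall i, upper_smooth L (f i)) -> (forall i, lower_smooth l (f i)) ->
  strongly_convex sigma (favg f) ->
  mean (fun i => dotp (grad (f i) x - grad (f i) y) (grad (f i) x - grad (f i) y))
  <= 2 * (L + l) * (favg f x - favg f y - dotp (grad (favg f) y) (x - y)
                    + l / 2 * dotp (x - y) (x - y)).
Proof.
move=> l0 M0 s0 up lo cvx; set v := x - y.
have vv := dotp_ge0 v.
have cg : 0 <= dotp (grad (favg f) x - grad (favg f) y) v.
  have := strongly_convex_monotone x y cvx; apply: le_trans.
  by rewrite mulr_ge0.
have h : mean (fun i => dotp (grad (f i) x - grad (f i) y) (grad (f i) x - grad (f i) y)
     + 2 * l * dotp (grad (f i) x - grad (f i) y) v + l * l * dotp v v)
   <= mean (fun i => 2 * (L + l) * (f i x - f i y - dotp (grad (f i) y) v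
                    + l / 2 * dotp v v)).
  apply: le_mean => i; have := grad_gap x y M0 (up i) (lo i).
  rewrite -/v; apply: le_trans; set g := grad _ x - grad _ y.
  clearbody g v; rewrite !dotpDl !dotpDr !dotpZl !dotpZr (dotpC v g); lra.
clearbody v.
move: h; rewrite meanZ !meanD !meanN !mean_const ?card_ord // meanZ.
have -> : mean (fun i => dotp (grad (f i) x - grad (f i) y) v)
    = dotp (grad (favg f) x - grad (favg f) y) v.
  rewrite dotpBl !dotp_grad_favg -meanN -meanD.
  by apply: eq_mean => i; rewrite dotpBl.
rewrite -!favg_mean -dotp_grad_favg; apply: le_trans.
by rewrite -addrA lerDl addr_ge0 // !mulr_ge0.
Qed.

End FiniteSum.

(** * The step length and the epoch length that it requires *)

Section StepLength.
Context {R : realType}.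
Variables L l sigma : R.
Hypothesis lL : 0 <= l <= L.
Hypothesis sigma0 : 0 < sigma.
Let eta := step_length L l sigma.

Lemma step_length_gt0 : 0 < L -> 0 < eta.
Proof.
move=> L0; rewrite /eta /step_length; case: eqVneq => [_|l0].
  by rewrite divr_gt0 // mulr_gt0.
have {}l0 : 0 < l by rewrite lt_def l0; case/andP: lL.
by rewrite lt_min !divr_gt0 // !mulr_gt0.
Qed.

Lemma step_length_L : 0 < L -> eta * L <= 1 / 21.
Proof.
move=> L0; have -> : 1 / 21 = 1 / (21 * L) * L by field; rewrite gt_eqF.
rewrite ler_wpM2r ?(ltW L0) // /eta /step_length.
by case: eqVneq => // _; rewrite ge_min lexx.
Qed.

Lemma step_length_Ll : 0 < L -> eta * (L * (l / sigma)) <= 1 / 63.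
Proof.
move=> L0; rewrite /eta /step_length; case: eqVneq => [->|l0].
  by rewrite mul0r !mulr0 divr_ge0.
have {}l0 : 0 < l by rewrite lt_def l0; case/andP: lL.
have -> : 1 / 63 = sigma / (63 * L * l) * (L * (l / sigma)) by field; rewrite !gt_eqF.
by rewrite ler_wpM2r ?ge_min ?lexx ?orbT // !mulr_ge0 ?invr_ge0 // ltW.
Qed.

(** For positive [l], the first candidate for the step length is 3 l / sigma times the second, so
    the active one changes at l / sigma = 1/3. Both estimates of the epoch length below are read off
    from these two cases. *)
Lemma epoch_length_cases :
  10 / (sigma * eta) = 210 * (L / sigma) /\ l / sigma <= 1 / 3
  \/ 10 / (sigma * eta) = 630 * (L / sigma * (l / sigma)) /\ 1 / 3 <= l / sigma.
Proof.
have [l0 lL'] := andP lL; have s0 : sigma != 0 by rewrite gt_eqF.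
have short : 10 / (sigma * (1 / (21 * L))) = 210 * (L / sigma).
  by rewrite div1r invfM invrK; field.
rewrite /eta /step_length; case: eqVneq => [->|ln0].
  by left; rewrite mul0r; split => //; exact: divr_ge0.
have {}l0 : 0 < l by rewrite lt_def ln0.
have L0 : 0 < L by exact: lt_le_trans lL'.
have cmp : (1 / (21 * L) <= sigma / (63 * L * l)) = (l / sigma <= 1 / 3).
  have -> : 1 / (21 * L) = (3 * (l / sigma)) * (sigma / (63 * L * l)) by field; rewrite s0 !gt_eqF.
  rewrite ger_pMl ?divr_gt0 ?mulr_gt0 //.
  by apply/idP/idP; lra.
have [h|h] := leP (1 / (21 * L)) (sigma / (63 * L * l)).
  by left; rewrite -cmp.
right; split; first by field; rewrite s0 !gt_eqF.
by move: h; rewrite ltNge cmp -ltNge => /ltW.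
Qed.

Lemma epoch_length_lower :
  Num.max (L / sigma) (L * l / sigma ^+ 2) <= 10 / (sigma * eta).
Proof.
have [l0 lL'] := andP lL; have L0 := le_trans l0 lL'.
have K0 : 0 <= L / sigma by rewrite divr_ge0 // ltW.
have -> : L * l / sigma ^+ 2 = L / sigma * (l / sigma) by field; rewrite gt_eqF.
rewrite ge_max; have [[-> h]|[-> h]] := epoch_length_cases;
  have := ler_wpM2l K0 h; move: K0; move: (L / sigma) (_ * (l / sigma)) => K Kl K0 hK;
  by apply/andP; split; lra.
Qed.

Lemma epoch_length_upper :
  10 / (sigma * eta) <= 630 * (L / sigma * Num.max 1 (l / sigma)).
Proof.
have [l0 lL'] := andP lL; have L0 := le_trans l0 lL'.
have K0 : 0 <= L / sigma by rewrite divr_ge0 // ltW.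
have h1 : L / sigma * 1 <= L / sigma * Num.max 1 (l / sigma).
  by rewrite ler_wpM2l // le_max lexx.
have h2 : L / sigma * (l / sigma) <= L / sigma * Num.max 1 (l / sigma).
  by rewrite ler_wpM2l // le_max lexx orbT.
by have [[-> _]|[-> _]] := epoch_length_cases; lra.
Qed.

End StepLength.

(** * Rounding up, and the number of epochs *)

Section CeilLog.
Context {R : realType}.
Implicit Types x r eps D : R.

Lemma ceilnE x : (ceiln x)%:R = (Num.ceil (Num.max 0 x))%:~R :> R.
Proof.
rewrite /ceiln natr_absz ger0_norm // ceil_ge0 (lt_le_trans (ltrN10 R)) //.
by rewrite le_max lexx.
Qed.

Lemma ceiln_ge x : x <= (ceiln x)%:R.
Proof. by rewrite ceilnE; apply: le_trans (ceil_ge _); rewrite le_max lexx orbT. Qed.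

Lemma ceiln_le x : (ceiln x)%:R <= Num.max 0 x + 1.
Proof.
rewrite ceilnE; have := gt_pred_ceil (Num.max 0 x).
by rewrite intrD => /ltW; lra.
Qed.

Lemma contraction_epochs D eps : 0 <= D -> 0 < eps ->
  (3 / 4) ^+ ceiln (log43 (D / eps)) * D <= eps.
Proof.
move=> D0 e0; set k := ceiln _.
have q0 : 0 <= 3 / 4 :> R by lra.
(* If the ratio is at most 1, any number of epochs will do. This branch also covers D = 0, where the
   logarithm has only a default value. *)
have [r1|r1] := leP (D / eps) 1.
  have De : D <= eps by rewrite -[eps]mul1r -ler_pdivrMr.
  apply: le_trans De; rewrite ler_piMl // exprn_ile1 //; lra.
have r0 : 0 < D / eps by rewrite (lt_trans ltr01).
have l43 : 0 < ln (4 / 3) :> R by rewrite ln_gt0 //; lra.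
have p0 : 0 < 4 / 3 :> R by lra.
have rk : D / eps <= (4 / 3) ^+ k.
  rewrite -ler_ln ?posrE ?exprn_gt0 // lnXn // -[leRHS]mulr_natl -ler_pdivrMr //.
  exact: ceiln_ge.
have -> : 3 / 4 = (4 / 3)^-1 :> R by field.
rewrite exprVn mulrC ler_pdivrMr ?exprn_gt0 // mulrC -ler_pdivrMr //.
Qed.

End CeilLog.

(** * Lower semicontinuity and attainment of minima *)

Section LowerSemicontinuity.
Context {R : realType}.

Lemma continuous_bigsum (T : topologicalType) (I : Type) (s : seq I)
    (F : I -> T -> R) : (forall i, continuous (F i)) ->
  continuous (fun y => \sum_(i <- s) F i y).
Proof.
move=> cF; elim: s => [|i s IH] z.
  by under eq_fun do rewrite big_nil; exact: cst_continuous.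
by under eq_fun do rewrite big_cons; apply: continuousD; [exact: cF|exact: IH].
Qed.

Lemma lower_semicontinuous_addl (T : topologicalType) (q : T -> R)
    (h : T -> \bar R) : continuous q -> lower_semicontinuous h ->
  lower_semicontinuous (fun y => (q y)%:E + h y)%E.
Proof.
move=> cq lh x a axh.
(* The level [b] splits [a]: near [x], [h] stays above [b] and [q] stays above [a - b]. *)
have [b ab bx] : exists2 b, a - q x < b & (b%:E < h x)%E.
  case: (h x) axh => [r| |] //=; last by exists (a - q x + 1); rewrite ?ltry //; first lra.
  rewrite -EFinD lte_fin => ar; by exists ((a - q x + r) / 2); rewrite ?lte_fin; lra.
have [V Vx bV] := lh x b bx.
exists (V `&` q @^-1` [set s | a - b < s]).
  apply: filterI => //; apply: (cq x); apply: open_nbhs_nbhs; split; first exact: open_gt.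
  by rewrite /=; lra.
move=> y [/bV by_ /= qy]; case: (h y) by_ => [r| |] //=; rewrite ?ltry // -?EFinD ?lte_fin; lra.
Qed.

(** The sublevel sets of [h] in [K] at levels above the infimum generate a proper filter.
    Compactness gives it a cluster point, and lower semicontinuity forces the value there down to
    the infimum. *)
Lemma compact_lower_semicontinuous_min (T : topologicalType) (h : T -> \bar R)
    (K : set T) : compact K -> K !=set0 -> lower_semicontinuous h ->
  exists2 x, K x & forall y, K y -> (h x <= h y)%E.
Proof.
move=> cK [x0 Kx0] lh; set m := ereal_inf (h @` K).
have mh y : K y -> (m <= h y)%E by move=> Ky; apply: ereal_inf_lbound; exists y.
have [mE|mlt] := eqVneq m +oo%E.
  by exists x0 => // y Ky; move: (mh _ Ky); rewrite mE leye_eq => /eqP ->; rewrite leey.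
have {}mlt : (m < +oo)%E by rewrite ltey.
pose S a := K `&` [set y | (h y <= a%:E)%E].
pose F := filter_from [set a : R | (m < a%:E)%E] S.
have SF a : (m < a%:E)%E -> F (S a) by move=> ma; exists a.
have [a0 ma0] : exists a : R, (m < a%:E)%E.
  case: {mh S F SF} m mlt => [r| |] // _; first by exists (r + 1); rewrite lte_fin; lra.
  by exists 0; rewrite ltNyr.
have FF : ProperFilter F.
  apply: filter_from_proper.
    apply: filter_from_filter; first by exists a0.
    move=> a b ma mb; exists (Num.min a b).
      by rewrite /= EFin_min lt_min ma mb.
    move=> y [Ky] /=; rewrite EFin_min le_min => /andP[ya yb]; by split; split.
  by move=> a /ereal_inf_lt[_ [y Ky <-] ya]; exists y; split=> //; exact: ltW.
have [x [Kx cx]] := cK F FF (filterS (fun y Sy => proj1 Sy) (SF a0 ma0)).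
exists x => // y Ky; apply: le_trans (mh y Ky); rewrite leNgt; apply/negP => mx.
(* A level strictly between the infimum and [h x]: some point near [x] would have a value both at
   most [a] and above [a]. *)
have [a ma ax] : exists2 a : R, (m < a%:E)%E & (a%:E < h x)%E.
  case: (h x) mx => [r| |] //; case: {mh S F SF FF cx ma0} m mlt => [s| |] // _ mx.
  - by exists ((s + r) / 2); rewrite lte_fin; move: mx; rewrite lte_fin; lra.
  - by exists (r - 1); rewrite ?ltNyr // lte_fin; lra.
  - by exists (s + 1); rewrite ?ltry // lte_fin; lra.
  - by exists 0; rewrite ?ltry ?ltNyr.
have [V Vx aV] := lh x a ax.
have [z [[Kz za] /aV az]] := cx _ _ (SF a ma) Vx.
by move: az; rewrite ltNge za.
Qed.

End LowerSemicontinuity.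

(** Stands in for the limit t -> 0 in the first-order optimality arguments. *)
Lemma le_of_lin_perturb {R : realType} (a b c : R) :
  (forall t, 0 < t <= 1 -> a <= b + c * t) -> a <= b.
Proof.
move=> h; apply/ler_addgt0Pr => e e0.
have c0 : 0 < `|c| + 1 by rewrite ltr_wpDl.
set t := Num.min 1 (e / (`|c| + 1)).
have t01 : 0 < t <= 1 by rewrite lt_min ltr01 divr_gt0 //= ge_min lexx.
apply: le_trans (h t t01) _; rewrite lerD2l.
have [t0 _] := andP t01.
apply: (@le_trans _ _ ((`|c| + 1) * t)).
  by rewrite ler_wpM2r ?(ltW t0) //; apply: le_trans (ler_norm c) _; rewrite lerDl.
by rewrite mulrC -ler_pdivlMr // ge_min lexx orbT.
Qed.

(** * Convexity and optimality for the composite objective *)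

Section Composite.
Context {R : realType} {d n : nat}.
Variables (f : 'I_n -> 'rV[R]_d -> R) (Psi : 'rV[R]_d -> \bar R).
Variables (L l sigma : R) (xs : 'rV[R]_d).
Hypothesis n0 : (0 < n)%N.
Hypothesis df : forall i x, differentiable (f i) x.
Hypothesis Psi_proper : proper_fun Psi.
Hypothesis Psi_convex : convex_ereal Psi.
Hypothesis Psi_lsc : lower_semicontinuous Psi.
Hypothesis lL : 0 <= l <= L.
Hypothesis f_upper : forall i, upper_smooth L (f i).
Hypothesis f_lower : forall i, lower_smooth l (f i).
Hypothesis sigma0 : 0 < sigma.
Hypothesis f_cvx : strongly_convex sigma (favg f).
Hypothesis xs_min : forall y, (objective f Psi xs <= objective f Psi y)%E.

Definition in_dom x := Psi x \is a fin_num.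
(** [fine] sends infinite values to 0, so [psi] and [obj_gap] are meaningful only on [in_dom]. *)
Definition psi x := fine (Psi x).
Definition obj_gap x := favg f x + psi x - (favg f xs + psi xs).

Lemma in_domP x : in_dom x <-> Psi x != +oo%E.
Proof. by have [h _] := Psi_proper; rewrite /in_dom fin_numE h. Qed.

Lemma xs_in_dom : in_dom xs.
Proof.
have [_ [y /in_domP Psiy]] := Psi_proper; apply/in_domP.
apply/eqP => Pxs; have := xs_min y; rewrite /objective Pxs addey //.
by rewrite -(fineK Psiy) -EFinD leye_eq.
Qed.

Lemma xs_le y : in_dom y -> favg f xs + psi xs <= favg f y + psi y.
Proof.
move=> Py; have := xs_min y.
by rewrite /objective -(fineK Py) -(fineK xs_in_dom) -!EFinD lee_fin.
Qed.

Lemma obj_gap_ge0 y : in_dom y -> 0 <= obj_gap y.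
Proof. by move=> Py; rewrite subr_ge0 xs_le. Qed.

Lemma psi_convex x y (t : R) : 0 <= t <= 1 -> in_dom x -> in_dom y ->
  in_dom (t *: x + (1 - t) *: y) /\
  psi (t *: x + (1 - t) *: y) <= t * psi x + (1 - t) * psi y.
Proof.
move=> t01 Px Py; have := Psi_convex x y t01.
rewrite -(fineK Px) -(fineK Py) -!EFinM -EFinD => le.
have Pz : in_dom (t *: x + (1 - t) *: y).
  by apply/in_domP; apply: contraTneq le => ->; rewrite leye_eq.
by split=> //; move: le; rewrite -(fineK Pz) lee_fin.
Qed.

Lemma psi_convexl x y (t : R) : 0 <= t <= 1 -> in_dom x -> in_dom y ->
  in_dom (y + t *: (x - y)) /\
  psi (y + t *: (x - y)) <= psi y + t * (psi x - psi y).
Proof.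
move=> t01 Px Py; have [] := psi_convex t01 Px Py.
have -> : t *: x + (1 - t) *: y = y + t *: (x - y).
  by rewrite scalerBl scale1r scalerBr addrCA.
by move=> Pz le; split=> //; lra.
Qed.

Lemma favg_up : upper_smooth L (favg f).
Proof. exact: favg_upper_smooth. Qed.

(** First-order optimality: minus the gradient of [favg f] at [xs] is a subgradient of [Psi] there.
    Compare [xs] with [xs + t *: v], divide by [t] and let [t] tend to 0; upper smoothness makes the
    error linear in [t]. *)
Lemma psi_subgradient y : in_dom y ->
  psi xs - psi y <= dotp (grad (favg f) xs) (y - xs).
Proof.
move=> Py; set v := y - xs; apply: (le_of_lin_perturb (c := L / 2 * dotp v v)) => t t01.
have [t0 t1] := andP t01.
have [Pz] := @psi_convexl y xs t (introT andP (conj (ltW t0) t1)) Py xs_in_dom.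
have := xs_le Pz; have := favg_up xs (xs + t *: v).
have -> : xs + t *: v - xs = t *: v by rewrite addrAC subrr add0r.
rewrite -/v enorm_sqr dotpZr dotpZl dotpZr => h1 h2 h3.
rewrite -(ler_pM2l t0); move: h1 h2 h3; set g := dotp _ v; set q := dotp v v.
set z := xs + _ => h1 h2 h3.
have -> : t * (g + L / 2 * q * t) = t * g + L / 2 * (t * (t * q)) by ring.
by lra.
Qed.

Lemma bregman_le_gap y : in_dom y ->
  favg f y - favg f xs - dotp (grad (favg f) xs) (y - xs) <= obj_gap y.
Proof. by move=> Py; have := psi_subgradient Py; rewrite /obj_gap; lra. Qed.

Lemma sqdist_le_gap y : in_dom y -> sigma / 2 * dotp (y - xs) (y - xs) <= obj_gap y.
Proof.
by move=> /bregman_le_gap; apply: le_trans; rewrite -enorm_sqr; exact: f_cvx.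
Qed.

Definition svrg_step (eta : R) (xt x : 'rV[R]_d) (i : 'I_n) :=
  prox_step Psi eta (grad (f i) x - grad (f i) xt + grad (favg f) xt) x.

(** * The proximal step: existence, optimality and descent *)

Section Prox.
Hypothesis L0 : 0 < L.
Variable eta : R.
Hypothesis eta0 : 0 < eta.

Lemma continuous_quadratic (xi x : 'rV[R]_d) :
  continuous (fun y : 'rV[R]_d => 1 / (2 * eta) * enorm (x - y) ^+ 2 + dotp xi y).
Proof.
have gen (T : topologicalType) (c : 'I_d -> T -> R) : (forall j, continuous (c j)) ->
    continuous (fun y => 1 / (2 * eta) * (\sum_(j < d) (x 0 j - c j y) * (x 0 j - c j y))
      + \sum_(j < d) xi 0 j * c j y).
  move=> cc; have cb j : continuous (fun y => x 0 j - c j y).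
    by move=> z; apply: cvgB; [exact: cvg_cst|exact: cc].
  move=> z; apply: cvgD.
    apply: cvgM; first exact: cvg_cst.
    by apply: continuous_bigsum => j y; apply: cvgM; exact: cb.
  apply: continuous_bigsum => j y.
  by apply: cvgM; [exact: cvg_cst|exact: cc].
have -> : (fun y : 'rV[R]_d => 1 / (2 * eta) * enorm (x - y) ^+ 2 + dotp xi y) =
    fun y => 1 / (2 * eta) * (\sum_(j < d) (x 0 j - y 0 j) * (x 0 j - y 0 j))
      + \sum_(j < d) xi 0 j * y 0 j.
  by apply/funext => y; rewrite enorm_sqr /dotp; under eq_bigr do rewrite !mxE.
by apply: (gen _ (fun j (y : 'rV[R]_d) => y 0 j)) => j; exact: coord_continuous.
Qed.

Let prox_obj xi x (y : 'rV[R]_d) : \bar R :=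
  ((1 / (2 * eta) * enorm (x - y) ^+ 2)%:E + Psi y + (dotp xi y)%:E)%E.

(* [psi] has the affine minorant given by the gradient of f at xs, so the
   prox objective can only fall below its value at xs in a bounded box. *)
Lemma prox_obj_min xi x : exists p, forall y, (prox_obj xi x p <= prox_obj xi x y)%E.
Proof.
have prox_objE : prox_obj xi x =
    fun y => ((1 / (2 * eta) * enorm (x - y) ^+ 2 + dotp xi y)%:E + Psi y)%E.
  by apply/funext => y; rewrite /prox_obj addeAC EFinD.
(* With v = y - xs, the prox objective at [y] minus its value at [xs] is at least |v|^2 / (2 eta) +
   <z, v>. If this is negative, |v + 2 eta z|^2 >= 0 gives |v|^2 <= 4 eta^2 |z|^2. *)
set z := xi - grad (favg f) xs - eta^-1 *: (x - xs).
(* Adding 1 avoids a square root: since rho >= 1, |v|^2 <= rho implies |v_j| <= rho. *)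
set rho := 1 + 4 * eta ^+ 2 * dotp z z.
have rho1 : 1 <= rho by rewrite lerDl mulr_ge0 ?dotp_ge0 // mulr_ge0 ?sqr_ge0.
pose K : set 'rV[R]_d := [set v | forall j, [set` `[xs 0 j - rho, xs 0 j + rho]] (v 0 j)].
have cK : compact K.
  by apply: (@rV_compact R d (fun j => [set` `[xs 0 j - rho, xs 0 j + rho]])) => j; exact: segment_compact.
have Kxs : K xs by move=> j /=; rewrite in_itv /=; apply/andP; split; lra.
have lsc : lower_semicontinuous (prox_obj xi x).
  by rewrite prox_objE; apply: lower_semicontinuous_addl => //; exact: continuous_quadratic.
have [p Kp pmin] := compact_lower_semicontinuous_min cK (ex_intro _ xs Kxs) lsc.
exists p => y; have [Ky|nKy] := pselect (K y); first exact: pmin.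
apply: le_trans (pmin xs Kxs) _.
have [Py|] := boolP (in_dom y); last first.
  by move/negP => /in_domP/negP; rewrite negbK prox_objE => /eqP ->; rewrite addey ?leey.
rewrite prox_objE -(fineK Py) -(fineK xs_in_dom) -!EFinD lee_fin leNgt.
apply/negP => lt_yx; apply: nKy => j /=.
set v := y - xs.
suff vz : dotp v v <= 4 * eta ^+ 2 * dotp z z.
  have : `|v 0 j| <= rho.
    have {}vz := le_trans (coord_sqr_le v j) vz.
    rewrite -(@ler_pXn2r _ 2) ?nnegrE // ?(le_trans _ rho1) // real_normK ?num_real //.
    apply: (@le_trans _ _ (rho * 1)); first by rewrite mulr1 /rho; lra.
    by rewrite expr2 ler_pM2l // (lt_le_trans _ rho1).
  by rewrite /v !mxE ler_norml in_itv /= => /andP[? ?]; apply/andP; split; lra.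
move: lt_yx; have -> : x - y = x - xs - v by rewrite /v opprB addrA subrK.
have := psi_subgradient Py; rewrite -/v -!/(psi _).
have -> : dotp xi y = dotp xi xs + dotp xi v by rewrite /v dotpBr addrC subrK.
have := dotp_ge0 (v + (2 * eta) *: z).
have zE w : eta * dotp z w = eta * (dotp xi w - dotp (grad (favg f) xs) w) - dotp (x - xs) w.
  by rewrite /z (dotpBl _ (eta^-1 *: _)) (dotpBl xi) dotpZl mulrBr mulrA mulfV ?gt_eqF // mul1r.
have := zE v; rewrite !enorm_sqr {zE}; set u := x - xs.
clearbody v z u; rewrite !dotpDl !dotpDr !dotpNl !dotpNr !dotpZl !dotpZr (dotpC v z) (dotpC v u).
set k := 1 / (2 * eta); have ke : k * eta = 1 / 2 by rewrite /k; field; rewrite gt_eqF.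
move=> zv sq sub lt.
have {sub}lt : k * (dotp v v - 2 * dotp u v)
    + (dotp xi v - dotp (grad (favg f) xs) v) < 0 by lra.
move: lt; rewrite -(ltr_pM2l eta0) mulr0.
have -> : eta * (k * (dotp v v - 2 * dotp u v)
    + (dotp xi v - dotp (grad (favg f) xs) v)) = dotp v v / 2 + eta * dotp z v.
  by rewrite zv mulrDr mulrA (mulrC eta k) ke; lra.
by lra.
Qed.

(** Existence of a minimizer excludes the default value of [argmin], and finiteness of the prox
    objective at [xs] makes its minimum finite. *)
Lemma prox_step_min xi x : in_dom (prox_step Psi eta xi x) /\
  forall y, in_dom y ->
    let h z := 1 / (2 * eta) * dotp (x - z) (x - z) + psi z + dotp xi z in
    h (prox_step Psi eta xi x) <= h y.
Proof.
set p := prox_step Psi eta xi x.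
have pmin y : (prox_obj xi x p <= prox_obj xi x y)%E.
  exact: (xgetPex 0 (prox_obj_min xi x)) y.
have Pp : in_dom p.
  apply/in_domP; apply/eqP => Pp; have := pmin xs.
  by rewrite /prox_obj Pp addey // addye // -(fineK xs_in_dom) -!EFinD leye_eq.
split=> // y Py; have := pmin y.
by rewrite /prox_obj -(fineK Pp) -(fineK Py) -!EFinD lee_fin !enorm_sqr.
Qed.

Lemma prox_step_dom xi x : in_dom (prox_step Psi eta xi x).
Proof. by have [] := prox_step_min xi x. Qed.

(** Compare [p] with points of the segment towards [y] and let them tend to [p]; the extra square of
    [y - p] comes from the strong convexity of the quadratic term. *)
Lemma prox_step_three_point xi x y p : p = prox_step Psi eta xi x -> in_dom y ->
  1 / (2 * eta) * (dotp (x - p) (x - p) + dotp (y - p) (y - p)) + psi p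
    + dotp xi (p - y) <= 1 / (2 * eta) * dotp (x - y) (x - y) + psi y.
Proof.
move=> pE Py; have [Pp pmin] := prox_step_min xi x; rewrite -pE /= in Pp pmin.
set k := 1 / (2 * eta) in pmin *; set w := y - p.
have -> : x - y = x - p - w by rewrite /w opprB addrA subrK.
have -> : p - y = - w by rewrite opprB.
suff : 0 <= - (2 * k) * dotp (x - p) w + psi y - psi p + dotp xi w.
  by set a := x - p; clearbody a w; rewrite !dotpE (dotpC w a); lra.
apply: (le_of_lin_perturb (c := k * dotp w w)) => t t01.
have [t0 t1] := andP t01.
have [Pz] := @psi_convexl y p t (introT andP (conj (ltW t0) t1)) Py Pp.
have := pmin _ Pz; rewrite -/w.
have -> : x - (p + t *: w) = x - p - t *: w by rewrite opprD addrA.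
set a := x - p; set z := p + _.
have -> : dotp xi z = dotp xi p + t * dotp xi w by rewrite dotpDr dotpZr.
clearbody a w z.
rewrite !dotpBl !dotpBr !dotpZl !dotpZr (dotpC w a) => h1 h2.
rewrite -(ler_pM2l t0) mulr0.
set ww := dotp w w in h1 *; set aw := dotp a w in h1 *.
have -> : t * (- (2 * k) * aw + psi y - psi p + dotp xi w + k * ww * t)
   = k * (- (2 * (t * aw)) + t * (t * ww)) + t * (psi y - psi p) + t * dotp xi w by ring.
by lra.
Qed.


Hypothesis etaL : eta * L <= 1 / 21.

(** Combines the three-point inequality at [xs], upper smoothness from [x] to [p], and convexity of
    [favg f] between [x] and [xs]. As eta L <= 1/21, the weight left on |x - p|^2 is at least 10 /
    (21 eta), whence the factor 21/40 eta on the squared gradient error. *)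
Lemma prox_step_descent xi x p : p = prox_step Psi eta xi x ->
  obj_gap p + 1 / (2 * eta) * dotp (p - xs) (p - xs)
  <= 1 / (2 * eta) * dotp (x - xs) (x - xs)
     + dotp (xi - grad (favg f) x) (xs - x)
     + 21 / 40 * eta * dotp (xi - grad (favg f) x) (xi - grad (favg f) x).
Proof.
move=> pE; have := prox_step_three_point pE xs_in_dom.
have := favg_up x p; have := f_cvx x xs; rewrite !enorm_sqr.
have : 0 <= sigma / 2 * dotp (xs - x) (xs - x) by rewrite mulr_ge0 ?dotp_ge0 // divr_ge0 // ltW.
rewrite /obj_gap; set b := x - p; set v := xs - x; set g := grad _ x; set del := xi - g.
have -> : p - x = - b by rewrite opprB.
have -> : p - xs = - (v + b) by rewrite addrA subrK opprB.
have -> : xs - p = v + b by rewrite addrA subrK.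
have -> : x - xs = - v by rewrite opprB.
have -> : xi = g + del by rewrite /del addrC subrK.
clearbody b g del v; move=> vv.
set k := 1 / (2 * eta); have ke : eta * k = 1 / 2 by rewrite /k; field; rewrite gt_eqF.
(* AM-GM on <del, b>, with the weight left over from k |b|^2 - L/2 |b|^2 *)
have : 0 <= dotp (b - (21 / 20 * eta) *: del) (b - (21 / 20 * eta) *: del) by exact: dotp_ge0.
rewrite !dotpE (dotpC b del).
set bb := dotp b b; set db := dotp del b; set dd := dotp del del => sq.
have amgm : db <= (k - L / 2) * bb + 21 / 40 * eta * dd.
  have bb0 : 0 <= bb by exact: dotp_ge0.
  rewrite -(ler_pM2l eta0).
  have -> : eta * ((k - L / 2) * bb + 21 / 40 * eta * dd)
     = (eta * k - eta * L / 2) * bb + 21 / 40 * (eta * eta * dd) by ring.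
  rewrite ke.
  have h : eta * L * bb <= 1 / 21 * bb by exact: ler_wpM2r.
  have {}sq : 0 <= bb - 21 / 10 * (eta * db) + 441 / 400 * (eta * eta * dd) by lra.
  by lra.
by lra.
Qed.

Hypothesis etaLl : eta * (L * (l / sigma)) <= 1 / 63.

(** Since L + l <= 2 L, the constant is 4 (1/21 + 1/63) = 16/63. *)
Lemma grad_variance_gap x : in_dom x ->
  eta * mean (fun i => dotp (grad (f i) x - grad (f i) xs) (grad (f i) x - grad (f i) xs))
  <= 16 / 63 * obj_gap x.
Proof.
move=> Px; have /andP[l0 lL'] := lL.
have Ll0 : 0 < L + l by rewrite ltr_wpDr.
have := grad_variance n0 df x xs l0 Ll0 (ltW sigma0) f_upper f_lower f_cvx.
have := bregman_le_gap Px; have := sqdist_le_gap Px; have D0 := obj_gap_ge0 Px.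
set B := _ - _ - dotp _ _; set q := dotp _ _; set D := obj_gap x in D0 *; set V := mean _.
move=> qD BD VB.
have lq : l / 2 * q <= l / sigma * D.
  have -> : l / 2 * q = l / sigma * (sigma / 2 * q) by field; rewrite gt_eqF.
  by apply: ler_wpM2l => //; rewrite divr_ge0 // ltW.
have lD0 : 0 <= l / sigma * D by rewrite mulr_ge0 // divr_ge0 // ltW.
have VD : V <= 4 * L * (D + l / sigma * D).
  apply: le_trans VB _; apply: ler_pM; [lra| |lra|lra].
  by rewrite addr_ge0 ?mulr_ge0 ?divr_ge0 ?dotp_ge0 // (le_trans _ (f_cvx xs x)) // mulr_ge0 ?sqr_ge0 // divr_ge0 // ltW.
have := ler_wpM2l (ltW eta0) VD.
have -> : eta * (4 * L * (D + l / sigma * D)) = 4 * (eta * L * D + eta * (L * (l / sigma)) * D) by ring.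
have := ler_wpM2r D0 etaL; have := ler_wpM2r D0 etaLl; lra.
Qed.

(** The estimator is unbiased, so the linear error term averages out. Its variance is at most the
    second moment of [g], which is split at [xs]; the constant is 21/40 * 2 * 16/63 = 4/15. *)
Lemma svrg_step_descent x xt : in_dom x -> in_dom xt ->
  mean (fun i => obj_gap (svrg_step eta xt x i) + 1 / (2 * eta) *
      dotp (svrg_step eta xt x i - xs) (svrg_step eta xt x i - xs))
   <= 1 / (2 * eta) * dotp (x - xs) (x - xs) + 4 / 15 * (obj_gap x + obj_gap xt).
Proof.
have combine (e p q Dx Dt : R) : e * p <= 16 / 63 * Dx -> e * q <= 16 / 63 * Dt ->
    21 / 40 * (e * (2 * p + 2 * q)) <= 4 / 15 * (Dx + Dt) by lra.
have c0 : 0 <= 21 / 40 :> R by lra.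
move=> Px Pxt.
pose g i := grad (f i) x - grad (f i) xt; pose h := grad (favg f) x - grad (favg f) xt.
have T0 : (0 < #|'I_n|)%N by rewrite card_ord.
have delE i : grad (f i) x - grad (f i) xt + grad (favg f) xt - grad (favg f) x = g i - h.
  by rewrite /h opprB addrA.
have gh v : mean (fun i => dotp (g i) v) = dotp h v.
  rewrite [RHS]dotpBl !dotp_grad_favg // -meanN -meanD.
  by apply: eq_mean => i; rewrite [LHS]dotpBl.
have step : mean (fun i => obj_gap (svrg_step eta xt x i) + 1 / (2 * eta) *
      dotp (svrg_step eta xt x i - xs) (svrg_step eta xt x i - xs))
    <= 1 / (2 * eta) * dotp (x - xs) (x - xs)
       + 21 / 40 * eta * mean (fun i => dotp (g i - h) (g i - h)).
  set c := _ * dotp (x - xs) _; pose v := xs - x.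
  have <- : mean (fun i => c + (dotp (g i) v - dotp h v)
      + 21 / 40 * eta * dotp (g i - h) (g i - h))
    = c + 21 / 40 * eta * mean (fun i => dotp (g i - h) (g i - h)).
    rewrite meanD (meanD (fun=> c)) (meanD (fun i => dotp (g i) v)).
    by rewrite !(mean_const _ T0) gh subrr addr0 meanZ.
  apply: le_mean => i; apply: le_trans (prox_step_descent (erefl _)) _.
  by rewrite delE [dotp (g i - h) (xs - x)]dotpBl.
have cen := mean_sq_center T0 gh.
have par : mean (fun i => dotp (g i) (g i)) <=
    2 * mean (fun i => dotp (grad (f i) x - grad (f i) xs) (grad (f i) x - grad (f i) xs))
    + 2 * mean (fun i => dotp (grad (f i) xt - grad (f i) xs) (grad (f i) xt - grad (f i) xs)).
  apply: le_trans (mean_sqB _ _); apply: le_mean => i.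
  by rewrite opprB addrA subrK.
apply: le_trans step _; rewrite lerD2l -mulrA.
apply: le_trans (combine _ _ _ _ _ (grad_variance_gap Px) (grad_variance_gap Pxt)).
apply: (ler_wpM2l c0); apply: (ler_wpM2l (ltW eta0)).
exact: le_trans cen par.
Qed.

(** The distance terms telescope. Each new iterate spends 4/15 of its gap on the bound for the next
    step, which leaves 11/15; only the gap of the starting point remains on the right. *)
Lemma inner_loop_bound k x xt : in_dom x -> in_dom xt ->
  11 / 15 * mean (fun w : k.-tuple 'I_n =>
      \sum_(p <- scanl (svrg_step eta xt) x w) obj_gap p)
  <= 4 / 15 * obj_gap x + k%:R * (4 / 15 * obj_gap xt)
     + 1 / (2 * eta) * dotp (x - xs) (x - xs).
Proof.
move=> Px Pxt; elim: k x Px => [|k IH] x Px.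
  rewrite mean_tuple0 /= big_nil mulr0 mul0r addr0.
  have k0 : 0 <= 1 / (2 * eta) by rewrite divr_ge0 // mulr_ge0 // ltW.
  apply: addr_ge0; first by rewrite mulr_ge0 ?obj_gap_ge0 // divr_ge0.
  by rewrite (mulr_ge0 k0) ?dotp_ge0.
set c := k%:R * (4 / 15 * obj_gap xt).
rewrite mean_tuple_cons -meanZ.
apply: (@le_trans _ _ (mean (fun i =>
   (obj_gap (svrg_step eta xt x i) + 1 / (2 * eta) *
      dotp (svrg_step eta xt x i - xs) (svrg_step eta xt x i - xs)) + c))).
  apply: le_mean => i; set y := svrg_step eta xt x i.
  have Py : in_dom y by exact: prox_step_dom.
  under [X in _ * X]eq_mean => w do rewrite /= big_cons -/y.
  have T0 : (0 < #|{: k.-tuple 'I_n}|)%N by rewrite card_tuple expn_gt0 card_ord n0.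
  rewrite meanD mean_const //.
  have := IH y Py; rewrite -/c; lra.
rewrite meanD mean_const ?card_ord //.
have := svrg_step_descent Px Pxt; rewrite /c -natr1 mulrDl mul1r; lra.
Qed.

(** * Jensen's inequality for the average of the iterates *)

Lemma obj_gap_convexl x y (t : R) : 0 <= t <= 1 -> in_dom x -> in_dom y ->
  in_dom (y + t *: (x - y)) /\
  obj_gap (y + t *: (x - y)) <= obj_gap y + t * (obj_gap x - obj_gap y).
Proof.
move=> t01 Px Py; have [Pz pz] := psi_convexl t01 Px Py; split=> //.
move: pz; set v := x - y; set z := y + _ => pz.
(* Convexity of [favg f] enters through its tangent at the combination [z]: in the weighted sum of
   the bounds at [x] and [y] the linear terms cancel. *)
have tangent u : favg f z + dotp (grad (favg f) z) (u - z) <= favg f u.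
  have := f_cvx z u; have : 0 <= sigma / 2 * enorm (u - z) ^+ 2.
    by rewrite mulr_ge0 ?sqr_ge0 // divr_ge0 // ltW.
  lra.
have := tangent x; have := tangent y.
have -> : x - z = (1 - t) *: v by rewrite scalerBl scale1r /v /z opprD addrA.
have -> : y - z = - (t *: v) by rewrite /z opprD addrA subrr add0r.
rewrite dotpNr !dotpZr; move/andP: t01 => [t0 t1] hy hx.
have {}hy := ler_wpM2l (_ : 0 <= 1 - t) hy; have {}hx := ler_wpM2l t0 hx.
rewrite subr_ge0 in hy; have {}hy := hy t1.
by rewrite /obj_gap; lra.
Qed.

(** By induction: the new average is the convex combination of [x], with weight 1/(k + 1), and the
    average of the other [k] points. *)
Lemma obj_gap_average x s : in_dom x -> all in_dom s ->
  let k : R := (size s).+1%:R in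
  in_dom (k^-1 *: \sum_(p <- x :: s) p) /\
  obj_gap (k^-1 *: \sum_(p <- x :: s) p) <= k^-1 * \sum_(p <- x :: s) obj_gap p.
Proof.
elim: s x => [|y s IH] x Px /=.
  by rewrite !big_seq1 invr1 scale1r mul1r.
move=> /andP[Py Ps]; have [Pz zle] := IH y Py Ps; move: Pz zle => /=.
set k := (size s).+1%:R; rewrite !(big_cons _ _ x) -[(size s).+2%:R]natr1 -/k.
set Y := \sum_(p <- y :: s) p; set D := \sum_(p <- y :: s) obj_gap p => Pz zle.
have k0 : 0 < k by rewrite ltr0n.
have t01 : 0 <= (k + 1)^-1 <= 1.
  by rewrite invr_ge0 addr_ge0 ?(ltW k0) //= invf_le1 ?lerDr ?ltW // ltr_wpDr.
have [] := obj_gap_convexl t01 Px Pz.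
have kk : k + 1 != 0 by rewrite gt_eqF // ltr_wpDr.
have -> : k^-1 *: Y + (k + 1)^-1 *: (x - k^-1 *: Y) = (k + 1)^-1 *: (x + Y).
  rewrite scalerBr scalerDr addrCA scalerA -scalerBl; congr (_ + _ *: _).
  by field; rewrite gt_eqF //= gt_eqF // ltr_wpDr.
move=> Pw wle; split=> //; apply: le_trans wle _.
have -> : (k + 1)^-1 * (obj_gap x + D) = (1 - (k + 1)^-1) * (k^-1 * D) + (k + 1)^-1 * obj_gap x.
  by field; rewrite gt_eqF //= gt_eqF // ltr_wpDr.
have /andP[_ t1] := t01; rewrite -subr_ge0 in t1.
have := ler_wpM2l t1 zle.
move: (k + 1)^-1 (obj_gap x) (obj_gap (k^-1 *: Y)) (k^-1 * D) => *; lra.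
Qed.

Definition svrg_epoch m (xt : 'rV[R]_d) (w : m.-tuple 'I_n) : 'rV[R]_d :=
  m%:R^-1 *: \sum_(p <- scanl (svrg_step eta xt) xt w) p.

Lemma all_in_dom_iterates xt x (w : seq 'I_n) : all in_dom (scanl (svrg_step eta xt) x w).
Proof.
by elim: w x => [|i w IH] x //=; rewrite IH andbT prox_step_dom.
Qed.

Lemma svrg_epoch_average m xt (w : m.-tuple 'I_n) : (0 < m)%N ->
  in_dom (svrg_epoch xt w) /\
  obj_gap (svrg_epoch xt w)
  <= m%:R^-1 * \sum_(p <- scanl (svrg_step eta xt) xt w) obj_gap p.
Proof.
rewrite /svrg_epoch; move: (all_in_dom_iterates xt xt w) (size_scanl (svrg_step eta xt) xt w).
rewrite size_tuple; case: (scanl _ _ _) => [|y s] /=; first by move=> _ <-.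
by move=> /andP[Py Ps] <- _; exact: obj_gap_average.
Qed.

Hypothesis sigmaL : sigma <= L.

(** * Contraction over one epoch and over several *)

Section EpochLength.
Variable m : nat.
Hypothesis m_ge : 10 / (sigma * eta) <= m%:R.

Lemma epoch_length_ge : (210 : R) <= m%:R.
Proof.
apply: le_trans m_ge; rewrite ler_pdivlMr ?mulr_gt0 //.
have : eta * sigma <= eta * L by exact: ler_wpM2l (ltW eta0) _ _ sigmaL.
by have := etaL; lra.
Qed.

Lemma epoch_length_gt0 : (0 < m)%N.
Proof. by rewrite -(ltr0n R) (lt_le_trans _ epoch_length_ge). Qed.

Lemma epoch_contraction xt : in_dom xt ->
  mean (fun w : m.-tuple 'I_n => obj_gap (svrg_epoch xt w)) <= 3 / 4 * obj_gap xt.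
Proof.
move=> Pxt; have m210 := epoch_length_ge; have m0 := epoch_length_gt0.
apply: (@le_trans _ _ (mean (fun w : m.-tuple 'I_n =>
    m%:R^-1 * \sum_(p <- scanl (svrg_step eta xt) xt w) obj_gap p))).
  by apply: le_mean => w; have [] := svrg_epoch_average xt w m0.
rewrite meanZ ler_pdivrMl ?ltr0n //.
have := inner_loop_bound m Pxt Pxt; have := sqdist_le_gap Pxt.
have D0 := obj_gap_ge0 Pxt.
set q := dotp _ _; set D := obj_gap xt in D0 *; set S := mean _ => qD SD.
(* Strong convexity bounds the initial distance term by D / (sigma eta), hence by m D / 10. *)
have kq : 1 / (2 * eta) * q <= m%:R / 10 * D.
  apply: (@le_trans _ _ ((sigma * eta)^-1 * D)).
    have -> : 1 / (2 * eta) * q = (sigma * eta)^-1 * (sigma / 2 * q).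
      by field; rewrite !gt_eqF.
    by rewrite ler_wpM2l // invr_ge0 mulr_ge0 // ltW.
  by apply: ler_wpM2r => //; move: m_ge; lra.
(* It remains to see that 4/15 (m + 1) + m/10 <= 11/15 * 3/4 m. The coefficients of [m] are 11/30
   and 11/20, and the size of [m] absorbs the single 4/15. *)
have := ler_wpM2r D0 m210.
move: SD kq; have -> : m%:R * (4 / 15 * D) = 4 / 15 * (m%:R * D) by ring.
have -> : m%:R * (3 / 4 * D) = 3 / 4 * (m%:R * D) by ring.
have -> : m%:R / 10 * D = (m%:R * D) / 10 by ring.
lra.
Qed.

Lemma svrg_epochs_dom x (ws : seq (m.-tuple 'I_n)) : in_dom x ->
  in_dom (foldl (@svrg_epoch m) x ws).
Proof.
elim: ws x => [|w ws IH] x Px //=; apply: IH.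
by have [] := svrg_epoch_average x w epoch_length_gt0.
Qed.

(** Condition on the first epoch; the remaining ones contract from its output. *)
Lemma epochs_contraction k x : in_dom x ->
  mean (fun ws : k.-tuple (m.-tuple 'I_n) => obj_gap (foldl (@svrg_epoch m) x ws))
  <= (3 / 4) ^+ k * obj_gap x.
Proof.
elim: k x => [|k IH] x Px; first by rewrite mean_tuple0 /= expr0 mul1r.
rewrite mean_tuple_cons exprSr -mulrA.
apply: (@le_trans _ _ (mean (fun w : m.-tuple 'I_n => (3 / 4) ^+ k * obj_gap (svrg_epoch x w)))).
  apply: le_mean => w /=; apply: IH.
  by have [] := svrg_epoch_average x w epoch_length_gt0.
rewrite meanZ ler_wpM2l ?exprn_ge0 ?divr_ge0 //.
exact: epoch_contraction.
Qed.

End EpochLength.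

End Prox.

(** * The algorithm without its counter, and the gradient count *)

Lemma scanl_inner_step eta xt (st : 'rV[R]_d * nat) (w : seq 'I_n) :
  [seq p.1 | p <- scanl (inner_step f Psi eta xt (grad (favg f) xt)) st w]
  = scanl (svrg_step eta xt) st.1 w.
Proof. by elim: w st => [|i w IH] st //=; rewrite IH. Qed.

Lemma epochE eta m st (w : m.-tuple 'I_n) :
  (epoch f Psi eta st w).1 = svrg_epoch eta st.1 w.
Proof.
rewrite /svrg_epoch -(scanl_inner_step eta st.1 (st.1, (st.2 + n)%N)) big_map.
by [].
Qed.

Lemma svrgE eta m x (ws : seq (m.-tuple 'I_n)) :
  svrg f Psi eta x ws = foldl (@svrg_epoch eta m) x ws.
Proof.
rewrite /svrg /svrg_run -[x in RHS]/((x, 0%N).1).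
move: (x, 0%N); elim: ws => [|w ws IH] st //.
by rewrite [LHS]IH epochE.
Qed.

Lemma epoch_count eta m st (w : m.-tuple 'I_n) :
  (epoch f Psi eta st w).2 = (st.2 + (n + 2 * m))%N.
Proof.
have gen xt mu p (s : seq 'I_n) :
    (last p (scanl (inner_step f Psi eta xt mu) p s)).2 = (p.2 + 2 * size s)%N.
  elim: s p => [|i s IH] p /=; first by rewrite muln0 addn0.
  by rewrite IH /= mulnS addnA.
by rewrite /epoch /= gen /= size_tuple addnA.
Qed.

Lemma gradient_complexityE eta m x (ws : seq (m.-tuple 'I_n)) :
  gradient_complexity f Psi eta x ws = (size ws * (n + 2 * m))%N.
Proof.
suff gen st : (foldl (epoch f Psi eta) st ws).2 = (st.2 + size ws * (n + 2 * m))%N.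
  by rewrite [LHS]gen.
elim: ws st => [|w ws IH] st; first by rewrite addn0.
by rewrite [LHS]IH epoch_count -addnA -mulSn.
Qed.

(** * Passage to the extended-real objective *)

Lemma objective_gap z : in_dom z ->
  (objective f Psi z - objective f Psi xs)%E = (obj_gap z)%:E.
Proof. by move=> Pz; rewrite /objective -(fineK Pz) -(fineK xs_in_dom) -!EFinD. Qed.

(** The one-epoch claim admits a starting point where [Psi] is infinite; its right side is then
    [+oo]. *)
Lemma objective_pinfty z : ~~ in_dom z ->
  (objective f Psi z - objective f Psi xs)%E = +oo%E.
Proof.
move/negP => /in_domP/negP; rewrite negbK => /eqP Pz.
by rewrite /objective Pz addey // -(fineK xs_in_dom) -EFinD.
Qed.

Lemma expect_objective (T : finType) (Z : T -> 'rV[R]_d) :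
  (forall w, in_dom (Z w)) ->
  expect (fun w => objective f Psi (Z w) - objective f Psi xs)%E
  = (mean (fun w => obj_gap (Z w)))%:E.
Proof.
move=> PZ; rewrite -expect_EFin; congr (_ * _)%E.
by apply: eq_bigr => w _; rewrite objective_gap.
Qed.

(** On a nonzero vector, strong convexity and upper smoothness bound the same quantity from both
    sides. This also supplies the positivity of [L]. *)
Lemma dim0_or_sigma_le : d = 0%N \/ sigma <= L.
Proof.
have [d0|d0] := posnP d; [by left|right].
pose e : 'rV[R]_d := delta_mx 0 (Ordinal d0).
have ee : 0 < dotp e e.
  have := coord_sqr_le e (Ordinal d0); rewrite mxE !eqxx expr1n.
  exact: lt_le_trans.
have := favg_up 0 e; have := f_cvx 0 e; rewrite subr0 enorm_sqr => lo up.
by move: (le_trans lo up); rewrite ler_pM2r // ler_pM2r.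
Qed.

(** * Expected decrease for the prescribed step length *)

Section Rates.
Let eta := step_length L l sigma.
Variable m : nat.
Hypothesis m_ge : 10 / (sigma * eta) <= m%:R.

(* In dimension 0 the smoothness constant L may vanish, and so may the step
   length; but then all points coincide. *)
Lemma expect_dim0 (T : finType) (Z : T -> 'rV[R]_d) : d = 0%N ->
  expect (fun w => objective f Psi (Z w) - objective f Psi xs)%E = 0%E.
Proof.
move=> d0; have Zxs w : Z w = xs by apply/rowP => j; exfalso; have := ltn_ord j; rewrite [X in (_ < X)%N]d0.
rewrite expect_objective => [|w]; last by rewrite Zxs xs_in_dom.
by rewrite /mean big1 ?mulr0 // => w _; rewrite Zxs /obj_gap subrr.
Qed.

Lemma expect_epoch xt : in_dom xt ->
  (expect (fun w : m.-tuple 'I_n =>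
     objective f Psi (svrg_epoch eta xt w) - objective f Psi xs)
   <= (3 / 4 * obj_gap xt)%:E)%E.
Proof.
move=> Pxt; have [d0|sL] := dim0_or_sigma_le.
  by rewrite expect_dim0 // lee_fin mulr_ge0 ?obj_gap_ge0 // divr_ge0.
have L0 : 0 < L by exact: lt_le_trans sL.
have eta0 := step_length_gt0 lL sigma0 L0.
have etaL := step_length_L l sigma L0.
have etaLl := step_length_Ll lL sigma0 L0.
rewrite expect_objective => [|w]; first by rewrite lee_fin; exact: epoch_contraction.
by have [] := svrg_epoch_average eta0 xt w (epoch_length_gt0 eta0 etaL sL m_ge).
Qed.

Lemma expect_epochs k x : in_dom x ->
  (expect (fun ws : k.-tuple (m.-tuple 'I_n) =>
     objective f Psi (foldl (@svrg_epoch eta m) x ws) - objective f Psi xs)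
   <= ((3 / 4) ^+ k * obj_gap x)%:E)%E.
Proof.
move=> Px; have [d0|sL] := dim0_or_sigma_le.
  by rewrite expect_dim0 // lee_fin mulr_ge0 ?obj_gap_ge0 // exprn_ge0 // divr_ge0.
have L0 : 0 < L by exact: lt_le_trans sL.
have eta0 := step_length_gt0 lL sigma0 L0.
have etaL := step_length_L l sigma L0.
have etaLl := step_length_Ll lL sigma0 L0.
rewrite expect_objective => [|ws]; first by rewrite lee_fin; exact: epochs_contraction.
exact: svrg_epochs_dom.
Qed.

End Rates.

End Composite.

Theorem theorem5p1 (R : realType) :
  exists c C : R, 0 < c /\ 0 < C /\
  forall (d n : nat) (f : 'I_n -> 'rV[R]_d -> R) (Psi : 'rV[R]_d -> \bar R)
    (L l sigma : R) (xstar : 'rV[R]_d),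
  (0 < n)%N ->
  (forall i x, differentiable (f i) x) ->
  proper_fun Psi -> convex_ereal Psi -> lower_semicontinuous Psi ->
  0 <= l <= L ->
  (forall i, upper_smooth L (f i)) ->
  (forall i, lower_smooth l (f i)) ->
  0 < sigma ->
  strongly_convex sigma (favg f) ->
  (forall y, (objective f Psi xstar <= objective f Psi y)%E) ->
  let F := objective f Psi in
  let eta := step_length L l sigma in
  c * Num.max (L / sigma) (L * l / sigma ^+ 2) <= 10 / (sigma * eta) /\
  (forall (m : nat) (x0 : 'rV[R]_d), 10 / (sigma * eta) <= m%:R ->
    (* one epoch, for every outcome hist of the k = s - 1 epochs before it *)
    forall (k : nat) (hist : k.-tuple (m.-tuple 'I_n)),
      (expect (fun w : m.-tuple 'I_n =>
         F (svrg f Psi eta x0 (rcons hist w)) - F xstar)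
       <= (3 / 4)%:E * (F (svrg f Psi eta x0 hist) - F xstar))%E) /\
  (forall (x0 : 'rV[R]_d) (eps : R), (F x0 < +oo)%E -> 0 < eps ->
    let ratio := fine (F x0 - F xstar)%E / eps in
    let nS := ceiln (log43 ratio) in
    (forall m : nat, 10 / (sigma * eta) <= m%:R ->
      (expect (fun ws : nS.-tuple (m.-tuple 'I_n) =>
         F (svrg f Psi eta x0 ws) - F xstar) <= eps%:E)%E) /\
    (* with the least admissible epoch length; the number of epochs is an
       integer, so for ratio <= 4 / 3 the logarithm is replaced by 1 *)
    (forall ws : nS.-tuple ((ceiln (10 / (sigma * eta))).-tuple 'I_n),
      (gradient_complexity f Psi eta x0 ws)%:R
      <= C * ((n%:R + L / sigma * Num.max 1 (l / sigma))
              * Num.max 1 (log43 ratio)))).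
Proof.
(* The second constant is 2 * 1260: there are at most 2 max(1, log) epochs, and n + 2 M <= n + 1260
   kappa + 2 <= 1260 (n + kappa) because n >= 1. *)
exists 1, 2520; split; first exact: ltr01.
split; first by rewrite ltr0n.
move=> d n f Psi L l sigma xstar n0 df pP cP lP lL up lo s0 cvx xmin F eta.
split; first by rewrite mul1r; exact: epoch_length_lower.
split=> [m x0 m_ge k hist|x0 eps Fx0 eps0 ratio nS].
  rewrite /F !svrgE; under eq_fun do rewrite svrgE foldl_rcons.
  (* The past matters only through the point that it reaches, so that point may be arbitrary. *)
  move: (foldl _ x0 hist) => x.
  have [Px|Px] := boolP (in_dom Psi x).
    by rewrite (objective_gap pP xmin Px) -EFinM; exact: expect_epoch.
  by rewrite (objective_pinfty pP xmin Px) gt0_muley ?leey // lte_fin; lra.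
have Px0 : in_dom Psi x0.
  apply/(in_domP pP); apply: contraTneq Fx0 => Px0.
  by rewrite /F /objective Px0 addey // ltxx.
have ratioE : ratio = obj_gap f Psi xstar x0 / eps.
  by rewrite /ratio /F (objective_gap pP xmin Px0).
split=> [m m_ge|ws].
  rewrite /F; under eq_fun do rewrite svrgE.
  have := expect_epochs n0 df pP cP lP lL up lo s0 cvx xmin m_ge nS Px0.
  move/le_trans; apply; rewrite lee_fin /nS ratioE.
  by apply: contraction_epochs => //; exact: obj_gap_ge0 pP xmin _ Px0.
set kappa := L / sigma * _; set M := ceiln _.
have n1 : 1 <= n%:R :> R by rewrite ler1n.
have M_le : M%:R <= 630 * kappa + 1.
  apply: le_trans (ceiln_le _) _; rewrite lerD2r ge_max epoch_length_upper // andbT.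
  have /andP[l0 lL'] := lL.
  apply: (mulr_ge0 (ler0n R 630)); apply: mulr_ge0; last by rewrite le_max ler01.
  exact: divr_ge0 (le_trans l0 lL') (ltW s0).
(* Rounding up costs 1, which the maximum with 1 absorbs. *)
have nS_le : nS%:R <= 2 * Num.max 1 (log43 ratio).
  apply: le_trans (ceiln_le _) _.
  have : 1 <= Num.max 1 (log43 ratio) by rewrite le_max lexx.
  have : Num.max 0 (log43 ratio) <= Num.max 1 (log43 ratio).
    by rewrite ge_max !le_max ler01 lexx orbT.
  by lra.
rewrite gradient_complexityE size_tuple natrM natrD natrM.
apply: (@le_trans _ _ (2 * Num.max 1 (log43 ratio) * (1260 * (n%:R + kappa)))); last by lra.
apply: ler_pM => //; lra.
Qed.
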